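(* Let $(X,\mathcal{F})$ and $(Y,\mathcal{G})$ be two generic dynamical systems where $\mathcal{F},\mathcal{G}$ are topological spaces. Suppose there exists a strong semiconjugacy from $(X,\mathcal{F})$ to $(Y,\mathcal{G})$. If $(X,\mathcal{F})$ is very strongly transitive, topologically mixing or locally eventually onto, then $(Y,\mathcal{G})$ satisfies the corresponding property.
   Context: A generic dynamical system (GDS) is a pair $(X,\mathcal{F})$ where $X$ is a compact metric space and $\mathcal{F}$ is a collection of continuous maps $X\to X$; here the set $\mathcal{F}$ is additionally equipped with some topology. A strong semiconjugacy from $(X,\mathcal{F})$ to $(Y,\mathcal{G})$ is a pair $(\phi,h)$ where $\phi:X\to Y$ and $h:\mathcal{F}\to\mathcal{G}$ are continuous surjective maps such that $\phi(f(x))=h(f)(\phi(x))$ for all $x\in X$, $f\in\mathcal{F}$. When $\mathcal{F}$ is a topological space, $(X,\mathcal{F})$ is: - very strongly transitive if for every nonempty open $U\subset X$ there exists a compact subset $S\subset\mathcal{F}$ such that $\bigcup_{f\in S}f(U)=X$; - topologically mixing if for all nonempty open $U,V\subset X$ there exists a compact subset $S\subset\mathcal{F}$ such that $f(U)\cap V\neq\emptyset$ for all $f\in\mathcal{F}\setminus S$; - locally eventually onto if for every nonempty open $U\subset X$ there exists a compact subset $S\subset\mathcal{F}$ such that $f(U)=X$ for all $f\in\mathcal{F}\setminus S$. *)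

(* Defs.v *)
From HB Require Import structures.
From mathcomp Require Import all_boot all_order all_algebra.
From mathcomp Require Import all_classical all_reals.
From mathcomp Require Import topology.

Set Implicit Arguments.
Unset Strict Implicit.
Unset Printing Implicit Defensive.

Local Open Scope classical_set_scope.

(* The topology on the collection of maps is an arbitrary piece of data: it
   need not be the topology induced by the library's canonical (pointwise
   convergence) topology on gds_space -> gds_space. *)
Record gds (R : realType) := Gds {
  gds_space : metricType R;
  gds_compact : compact [set: gds_space];
  gds_maps : set (gds_space -> gds_space);
  gds_continuous : forall f, gds_maps f -> continuous f;
  gds_topology : Topological (set_type gds_maps) }.

Arguments gds_maps {R} g _.

(* The type of elements of [gds_maps S], with [gds_topology S].  Packing by hand
   rather than by inference keeps the canonical subtype topology out. *)
Definition map_space (R : realType) (S : gds R) : topologicalType :=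
  Topological.Pack (gds_topology S).

Definition map_of (R : realType) (S : gds R) (f : map_space S) :
  gds_space S -> gds_space S := @set_val _ (gds_maps S) f.

Definition strong_semiconjugacy (R : realType) (S T : gds R)
    (phi : gds_space S -> gds_space T) (h : map_space S -> map_space T) : Prop :=
  [/\ continuous phi,
      set_surj setT setT phi,
      continuous h,
      set_surj setT setT h
    & forall x f, phi (map_of f x) = map_of (h f) (phi x)].

(* [compact] is the covering property, without Hausdorff separation. *)
Definition very_strongly_transitive (R : realType) (S : gds R) : Prop :=
  forall U : set (gds_space S), open U -> U !=set0 ->
  exists2 K : set (map_space S), compact K &
    \bigcup_(f in K) (map_of f @` U) = [set: gds_space S].

Definition topologically_mixing (R : realType) (S : gds R) : Prop :=
  forall U V : set (gds_space S), open U -> U !=set0 -> open V -> V !=set0 ->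
  exists2 K : set (map_space S), compact K &
    forall f, ~ K f -> (map_of f @` U) `&` V !=set0.

Definition locally_eventually_onto (R : realType) (S : gds R) : Prop :=
  forall U : set (gds_space S), open U -> U !=set0 ->
  exists2 K : set (map_space S), compact K &
    forall f, ~ K f -> map_of f @` U = [set: gds_space S].

(* Main.v *)
(* For a nonempty open U in Y, apply the hypothesis to the nonempty open set
   phi^-1(U), and take the compact set h(K) when K is the one obtained in F:
   phi(f(phi^-1(U))) is contained in h(f)(U), and every g outside h(K) is h(f)
   for some f outside K. *)
Require Import Defs.
From HB Require Import structures.
From mathcomp Require Import all_boot all_order all_algebra.
From mathcomp Require Import all_classical all_reals.
From mathcomp Require Import topology.

Set Implicit Arguments.
Unset Strict Implicit.
Unset Printing Implicit Defensive.

Local Open Scope classical_set_scope.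

Section Semiconjugacy.
Variables (R : realType) (S T : gds R).
Variables (phi : gds_space S -> gds_space T) (h : map_space S -> map_space T).
Hypothesis phih : strong_semiconjugacy phi h.

Lemma semiconj_preimage_open (U : set (gds_space T)) :
  open U -> open (phi @^-1` U).
Proof. by case: phih => cphi _ _ _ _; move/continuousP: cphi; apply. Qed.

Lemma semiconj_preimage_neq0 (U : set (gds_space T)) :
  U !=set0 -> phi @^-1` U !=set0.
Proof.
case: phih => _ sphi _ _ _ [y Uy].
by have [x _ xy] := sphi y I; exists x; rewrite /preimage/= xy.
Qed.

Lemma semiconj_image_compact (K : set (map_space S)) :
  compact K -> compact (h @` K).
Proof.
case: phih => _ _ ch _ _; apply: continuous_compact.
(* [continuous_compact] asks for continuity only on the subspace [K]; the global continuity of [h]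
   restricts to it. *)
exact: continuous_subspaceT.
Qed.

(** Equivariance turns [phi (f x)] into [h f] applied to [phi x], a point of [U]. This transfers
    every lower bound on images from [S] to [T]. *)
Lemma semiconj_image_sub (f : map_space S) (U : set (gds_space T)) :
  phi @` (map_of f @` (phi @^-1` U)) `<=` map_of (h f) @` U.
Proof.
case: phih => _ _ _ _ eqv _ [_ [x Ux <-] <-].
by exists (phi x) => //; rewrite eqv.
Qed.

(** Any preimage of [g] under the surjection [h] works: if it were in [K], then [g] would lie in the
    image of [K]. *)
Lemma semiconj_lift_notin (K : set (map_space S)) (g : map_space T) :
  ~ (h @` K) g -> exists2 f, ~ K f & h f = g.
Proof.
case: phih => _ _ _ sh _ nKg.
have [f _ fg] := sh g I.
by exists f => // Kf; apply: nKg; exists f.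
Qed.

Lemma semiconj_very_strongly_transitive :
  very_strongly_transitive S -> very_strongly_transitive T.
Proof.
move=> vst U oU U0.
have [K cK KT] := vst _ (semiconj_preimage_open oU) (semiconj_preimage_neq0 U0).
exists (h @` K); first exact: semiconj_image_compact.
(* Lift [y] to some [x], find an [f] in [K] whose image of the preimage of [U] contains [x], and
   push back down by [phi]. *)
rewrite -subTset => y _; case: phih => _ sphi _ _ _.
have [x _ <-] := sphi y I.
have [f Kf fx] : (\bigcup_(f in K) (map_of f @` (phi @^-1` U))) x by rewrite KT.
by exists (h f); [exists f | apply: semiconj_image_sub; exists x].
Qed.

Lemma semiconj_topologically_mixing :
  topologically_mixing S -> topologically_mixing T.
Proof.
move=> mix U V oU U0 oV V0.
have [K cK KP] := mix _ _ (semiconj_preimage_open oU)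
  (semiconj_preimage_neq0 U0) (semiconj_preimage_open oV)
  (semiconj_preimage_neq0 V0).
exists (h @` K); first exact: semiconj_image_compact.
(* Mixing in [S] puts [x] in the preimage of [V], so [phi x] is the common point. *)
move=> g /semiconj_lift_notin[f /KP[x [fx Vx]] <-].
by exists (phi x); split => //; apply: semiconj_image_sub; exists x.
Qed.

Lemma semiconj_locally_eventually_onto :
  locally_eventually_onto S -> locally_eventually_onto T.
Proof.
move=> leo U oU U0.
have [K cK KP] := leo _ (semiconj_preimage_open oU) (semiconj_preimage_neq0 U0).
exists (h @` K); first exact: semiconj_image_compact.
move=> g /semiconj_lift_notin[f /KP fT <-].
(* Here [f] reaches every lift [x] of [y], so [h f] reaches [y]. *)
rewrite -subTset => y _; case: phih => _ sphi _ _ _.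
have [x _ <-] := sphi y I.
by apply: semiconj_image_sub; exists x => //; rewrite fT.
Qed.

End Semiconjugacy.

Theorem theorem4p7 (R : realType) (S T : gds R) :
  (exists (phi : gds_space S -> gds_space T) (h : map_space S -> map_space T),
    strong_semiconjugacy phi h) ->
  [/\ very_strongly_transitive S -> very_strongly_transitive T,
      topologically_mixing S -> topologically_mixing T
    & locally_eventually_onto S -> locally_eventually_onto T].
Proof.
move=> [phi [h phih]]; split.
- exact: semiconj_very_strongly_transitive phih.
- exact: semiconj_topologically_mixing phih.
- exact: semiconj_locally_eventually_onto phih.
Qed.
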